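(* Let $p$ be a prime. A map $R\to S$ of animated commutative $\mathbf{F}_p$-algebras is an equivalence if and only if it is relatively perfect and the induced map $H^0(R)\to H^0(S)$ is an isomorphism of commutative rings.
   Context: Animated commutative $\mathbf{F}_p$-algebras (simplicial commutative $\mathbf{F}_p$-algebras up to weak equivalence) are indexed cohomologically, so $H^0(R)=\pi_0(R)$. Each such $R$ has a functorial Frobenius endomorphism $F=F_R$. For a map $R\to S$, let $S\otimes^L_{R,F}R$ be the pushout of $S\leftarrow R\xrightarrow{F}R$. The relative Frobenius map $F_{S/R}\colon S\otimes^L_{R,F}R\to S$ is induced by $F_S$ on the first factor and the structure map $R\to S$ on the second. The map $R\to S$ is relatively perfect if $F_{S/R}$ is an equivalence. *)

(* Defs.v *)
From HB Require Import structures.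
From mathcomp Require Import all_boot all_order all_algebra.
From mathcomp Require Import generic_quotient ring_quotient boolp.

Set Implicit Arguments.
Unset Strict Implicit.
Unset Printing Implicit Defensive.

Import GRing.Theory.
Local Open Scope ring_scope.
Local Open Scope quotient_scope.

Definition monotone m n (f : {ffun 'I_m.+1 -> 'I_n.+1}) : bool :=
  [forall i : 'I_m.+1, forall j : 'I_m.+1, (i <= j)%N ==> (f i <= f j)%N].

Lemma monotoneP m n (f : {ffun 'I_m.+1 -> 'I_n.+1}) :
  reflect (forall i j : 'I_m.+1, (i <= j)%N -> (f i <= f j)%N) (monotone f).
Proof.
apply: (iffP forallP) => [mf i j|mf i]; first by move: (forallP (mf i) j) => /implyP.
by apply/forallP => j; apply/implyP; apply: mf.
Qed.

(* [Delta m n] is the set of morphisms [m] -> [n], where [m] = {0 < ... < m}. *)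
Definition Delta m n := {f : {ffun 'I_m.+1 -> 'I_n.+1} | monotone f}.

Lemma Delta_id_subproof n : monotone [ffun i : 'I_n.+1 => i].
Proof. by apply/monotoneP => i j; rewrite !ffunE. Qed.

Definition Delta_id n : Delta n n := Sub _ (Delta_id_subproof n).

Lemma Delta_comp_subproof m n k (b : Delta n k) (a : Delta m n) :
  monotone [ffun i => val b (val a i)].
Proof.
apply/monotoneP => i j ij; rewrite !ffunE.
by apply: (monotoneP _ (valP b)); apply: (monotoneP _ (valP a)).
Qed.

Definition Delta_comp m n k (b : Delta n k) (a : Delta m n) : Delta m k :=
  Sub _ (Delta_comp_subproof b a).

Lemma coface_subproof n (i : 'I_n.+2) : monotone [ffun j : 'I_n.+1 => lift i j].
Proof. by apply/monotoneP => j k jk; rewrite !ffunE /= leq_bump2. Qed.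

Definition coface n (i : 'I_n.+2) : Delta n n.+1 := Sub _ (coface_subproof i).

Definition surjective_map m n (a : Delta m n) : Prop :=
  forall j, exists i, val a i = j.

(* An F_p-algebra is a commutative ring, possibly zero, in which p = 0; ring
   morphisms between such rings are automatically F_p-linear.  MathComp's
   [comAlgType] would exclude the zero ring. *)
Record sAlg (p : nat) := SAlg {
  sAlg_obj :> nat -> comPzRingType;
  act : forall m n, Delta m n -> {rmorphism sAlg_obj n -> sAlg_obj m};
  act_id : forall n x, act (Delta_id n) x = x;
  act_comp : forall m n k (b : Delta n k) (a : Delta m n) x,
    act (Delta_comp b a) x = act a (act b x);
  sAlg_char : forall n, p%:R = 0 :> sAlg_obj n
}.

Record sHom p (R S : sAlg p) := SHom {
  sHom_fun :> forall n, {rmorphism R n -> S n};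
  sHom_act : forall m n (a : Delta m n) x,
    sHom_fun m (act R a x) = act S a (sHom_fun n x)
}.

Lemma sHom_comp_subproof p (R S T : sAlg p) (g : sHom S T) (f : sHom R S)
    m n (a : Delta m n) (x : R n) :
  (g m \o f m) (act R a x) = act T a ((g n \o f n) x).
Proof. by rewrite /= !sHom_act. Qed.

Definition sHom_comp p (R S T : sAlg p) (g : sHom S T) (f : sHom R S) :
  sHom R T := SHom (sHom_fun := fun n => g n \o f n) (sHom_comp_subproof g f).

Definition sHom_eq p (R S : sAlg p) (f g : sHom R S) : Prop :=
  forall n x, f n x = g n x.

Lemma exprDn_prime (A : comPzRingType) p (x y : A) :
  prime p -> p%:R = 0 :> A -> (x + y) ^+ p = x ^+ p + y ^+ p.
Proof.
case: p => // p p_pr p0; rewrite exprDn big_ord_recl big_ord_recr /= big1 => [|i _].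
  by rewrite /bump /= add1n bin0 binn subn0 subnn !expr0 mulr1 mul1r !mulr1n add0r.
have /dvdnP[k ->] : (p.+1 %| 'C(p.+1, bump 0 i))%N.
  by rewrite prime_dvd_bin //= /bump /= add1n ltnS.
by rewrite -mulr_natr natrM p0 !mulr0.
Qed.

Section Frobenius.
Variables (p : nat) (p_pr : prime p) (R : sAlg p).

Definition frob_fun of prime p := fun n (x : R n) => x ^+ p.
Arguments frob_fun : clear implicits.
Local Notation F := (frob_fun p_pr).

Lemma frob_is_monoid_morphism n : monoid_morphism (F n).
Proof. by split => [|x y]; rewrite /frob_fun ?expr1n ?exprMn. Qed.

Lemma frob_is_nmod_morphism n : nmod_morphism (F n).
Proof.
rewrite /frob_fun; split => [|x y]; first by rewrite expr0n gtn_eqF ?prime_gt0.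
by rewrite exprDn_prime // sAlg_char.
Qed.

HB.instance Definition _ n :=
  GRing.isNmodMorphism.Build (R n) (R n) (F n) (@frob_is_nmod_morphism n).
HB.instance Definition _ n :=
  GRing.isMonoidMorphism.Build (R n) (R n) (F n) (@frob_is_monoid_morphism n).

Lemma frob_act m n (a : Delta m n) (x : R n) :
  F m (act R a x) = act R a (F n x).
Proof. by rewrite /frob_fun rmorphXn. Qed.

Definition frobenius : sHom R R :=
  SHom (sHom_fun := fun n => F n : {rmorphism R n -> R n}) frob_act.

End Frobenius.

(* Homotopy groups are the homology of the normalized (Moore) chain complex
   N_n = \bigcap_(i != 0) ker d_i, with differential d_0; H^0(R) = \pi_0(R) is
   the quotient of R_0 by the ideal of boundaries. *)
Section Homotopy.
Variables (p : nat) (R : sAlg p).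

Definition face n (i : 'I_n.+2) : {rmorphism R n.+1 -> R n} := act R (coface i).

Definition is_cycle n : R n -> Prop :=
  if n is n'.+1 then fun x : R n'.+1 => forall i, face i x = 0
  else fun=> True.

Definition is_boundary n (x : R n) : Prop :=
  exists2 y : R n.+1, face ord0 y = x & forall i, i != ord0 -> face i y = 0.

Definition cycle_pred n : {pred R n} := fun x => `[< is_cycle x >].

Lemma cycle_zmod_closed n : zmod_closed (@cycle_pred n).
Proof.
split=> [|x y]; rewrite !unfold_in.
  by apply/asboolP; case: n => //= n i; rewrite rmorph0.
move=> /asboolP cx /asboolP cy; apply/asboolP.
by case: n x y cx cy => //= n x y cx cy i; rewrite rmorphB cx cy subrr.
Qed.

HB.instance Definition _ n :=
  GRing.isZmodClosed.Build (R n) (@cycle_pred n) (@cycle_zmod_closed n).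

Record cycles n := Cycle { cycle_val : R n; _ : cycle_val \in @cycle_pred n }.

HB.instance Definition _ n := [isSub for @cycle_val n].
HB.instance Definition _ n := [Choice of cycles n by <:].
HB.instance Definition _ n := [SubChoice_isSubZmodule of cycles n by <:].

Definition boundary_pred n : {pred cycles n} := fun x => `[< is_boundary (val x) >].

Lemma boundary_zmod_closed n : zmod_closed (@boundary_pred n).
Proof.
split=> [|x y]; rewrite !unfold_in.
  by apply/asboolP; exists 0 => [|i _]; rewrite rmorph0.
move=> /asboolP[a ax aN] /asboolP[b bx bN]; apply/asboolP.
exists (a - b) => [|i i0]; first by rewrite rmorphB ax bx.
by rewrite rmorphB aN // bN // subrr.
Qed.

HB.instance Definition _ n :=
  GRing.isZmodClosed.Build (cycles n) (@boundary_pred n) (@boundary_zmod_closed n).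

Definition homotopy_group n : zmodType := Quotient.quot (@boundary_pred n).

Definition boundary0 : {pred R 0%N} := fun x => `[< is_boundary x >].

Lemma boundary0_zmod_closed : zmod_closed boundary0.
Proof.
split=> [|x y]; rewrite !unfold_in.
  by apply/asboolP; exists 0 => [|i _]; rewrite rmorph0.
move=> /asboolP[a ax aN] /asboolP[b bx bN]; apply/asboolP.
exists (a - b) => [|i i0]; first by rewrite rmorphB ax bx.
by rewrite rmorphB aN // bN // subrr.
Qed.

HB.instance Definition _ :=
  GRing.isZmodClosed.Build (R 0%N) boundary0 boundary0_zmod_closed.

Lemma codegeneracy0_subproof : monotone [ffun _ : 'I_2 => ord0 : 'I_1].
Proof. by apply/monotoneP => i j; rewrite !ffunE. Qed.

Definition codegeneracy0 : Delta 1 0 := Sub _ codegeneracy0_subproof.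

Lemma face_degeneracy0 (i : 'I_2) (x : R 0%N) : face i (act R codegeneracy0 x) = x.
Proof.
rewrite -act_comp -[RHS]act_id; congr (act R _ x).
by apply/val_inj/ffunP => j; rewrite !ffunE !ord1.
Qed.

Lemma boundary0M a x : x \in boundary0 -> a * x \in boundary0.
Proof.
rewrite !unfold_in => /asboolP[y yx yN]; apply/asboolP.
exists (act R codegeneracy0 a * y) => [|i i0].
  by rewrite rmorphM face_degeneracy0 yx.
by rewrite rmorphM yN // mulr0.
Qed.

Definition H0 := Quotient.quot boundary0.
HB.instance Definition _ := GRing.Zmodule.on H0.

Definition H0_proj (x : R 0%N) : H0 := \pi_(Quotient.quot boundary0) x.

Lemma H0_projP x y : reflect (H0_proj x = H0_proj y) (x - y \in boundary0).
Proof. by rewrite Quotient.idealrBE; apply: eqP. Qed.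

Lemma H0_projK : cancel (fun u : H0 => repr u) H0_proj.
Proof. by move=> u; rewrite /H0_proj reprK. Qed.

Lemma H0_projD : {morph H0_proj : x y / x + y}.
Proof. by move=> x y; rewrite /H0_proj raddfD. Qed.

Definition H0_one : H0 := H0_proj 1.
Definition H0_mul (u v : H0) : H0 := H0_proj (repr u * repr v).

Lemma H0_projM x y : H0_proj (x * y) = H0_mul (H0_proj x) (H0_proj y).
Proof.
apply/H0_projP; set x' := repr _; set y' := repr _.
have hx : x - x' \in boundary0 by apply/H0_projP; rewrite H0_projK.
have hy : y - y' \in boundary0 by apply/H0_projP; rewrite H0_projK.
have -> : x * y - x' * y' = y * (x - x') + x' * (y - y').
  by rewrite !mulrBr [y * x]mulrC [y * x']mulrC addrA subrK.
by rewrite rpredD ?boundary0M.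
Qed.

Lemma H0_mulA : associative H0_mul.
Proof.
move=> u v w; rewrite -[u]H0_projK -[v]H0_projK -[w]H0_projK.
by rewrite -!H0_projM mulrA.
Qed.

Lemma H0_mulC : commutative H0_mul.
Proof. by move=> u v; rewrite /H0_mul mulrC. Qed.

Lemma H0_mul1 : left_id H0_one H0_mul.
Proof. by move=> u; rewrite -[u]H0_projK -H0_projM mul1r. Qed.

Lemma H0_mulDl : left_distributive H0_mul +%R.
Proof.
move=> u v w; rewrite -[u]H0_projK -[v]H0_projK -[w]H0_projK.
by rewrite -H0_projD -!H0_projM mulrDl H0_projD.
Qed.

HB.instance Definition _ :=
  GRing.Zmodule_isComPzRing.Build H0 H0_mulA H0_mulC H0_mul1 H0_mulDl.

End Homotopy.

Section Induced.
Variables (p : nat) (R S : sAlg p) (f : sHom R S).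

Lemma sHom_cycle n (x : R n) : x \in @cycle_pred p R n -> f n x \in @cycle_pred p S n.
Proof.
rewrite !unfold_in => /asboolP cx; apply/asboolP.
by case: n x cx => //= n x cx i; rewrite /face -sHom_act [act _ _ _]cx raddf0.
Qed.

Lemma sHom_boundary n (x : R n) : is_boundary x -> is_boundary (f n x).
Proof.
case=> y yx yN; exists (f _ y) => [|i i0]; rewrite /face -sHom_act.
  by rewrite [act _ _ _]yx.
by rewrite [act _ _ _]yN // raddf0.
Qed.

Definition cycle_map n (x : cycles R n) : cycles S n := Cycle (sHom_cycle (valP x)).

Definition homotopy_map n (u : homotopy_group R n) : homotopy_group S n :=
  \pi_(Quotient.quot (@boundary_pred p S n)) (cycle_map (repr u)).

Definition H0_map (u : H0 R) : H0 S := H0_proj (f 0%N (repr u)).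

Lemma H0_map_proj x : H0_map (H0_proj x) = H0_proj (f 0%N x).
Proof.
apply/H0_projP; rewrite -raddfB unfold_in; apply/asboolP/sHom_boundary.
by apply/asboolP; change (repr (H0_proj x) - x \in @boundary0 p R);
   apply/H0_projP; rewrite H0_projK.
Qed.

Lemma homotopy_map_pi n (x : cycles R n) :
  homotopy_map (\pi_(Quotient.quot (@boundary_pred p R n)) x)
  = \pi_(Quotient.quot (@boundary_pred p S n)) (cycle_map x).
Proof.
apply/eqP; rewrite -Quotient.idealrBE unfold_in; apply/asboolP => /=.
rewrite -raddfB; apply: (@sHom_boundary n).
apply/asboolP; set y := repr _; change (y - x \in @boundary_pred p R n).
by rewrite Quotient.idealrBE /y reprK.
Qed.

Lemma H0_map_nmod_morphism : nmod_morphism H0_map.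
Proof.
split=> [|u v].
  have -> : 0 = H0_proj (0 : R 0%N) by rewrite /H0_proj raddf0.
  by rewrite H0_map_proj raddf0 /H0_proj raddf0.
rewrite -[u]H0_projK -[v]H0_projK -H0_projD !H0_map_proj.
by rewrite raddfD H0_projD.
Qed.

Lemma H0_map_monoid_morphism : monoid_morphism H0_map.
Proof.
split=> [|u v]; first by rewrite [1]/(H0_proj 1) H0_map_proj rmorph1.
rewrite -[u]H0_projK -[v]H0_projK -[_ * _]H0_projM !H0_map_proj.
by rewrite rmorphM H0_projM.
Qed.

HB.instance Definition _ :=
  GRing.isNmodMorphism.Build (H0 R) (H0 S) H0_map H0_map_nmod_morphism.
HB.instance Definition _ :=
  GRing.isMonoidMorphism.Build (H0 R) (H0 S) H0_map H0_map_monoid_morphism.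

Definition H0_hom : {rmorphism H0 R -> H0 S} := H0_map.

(* Equivalences of animated F_p-algebras are the maps represented by weak
   equivalences of simplicial algebras. *)
Definition equivalence : Prop := forall n, bijective (@homotopy_map n).

End Induced.

Definition ring_isomorphism (A B : comPzRingType) (h : {rmorphism A -> B}) : Prop :=
  bijective h.

(* B is the polynomial A-algebra on the subset X of B, along i. *)
Definition polynomial_on (A B : comPzRingType) (i : {rmorphism A -> B})
    (X : B -> Prop) : Prop :=
  (forall (T : comPzRingType) (h : {rmorphism A -> T}) (v : B -> T),
     exists k : {rmorphism B -> T},
       (forall a, k (i a) = h a) /\ (forall x, X x -> k x = v x)) /\
  (forall (T : comPzRingType) (k k' : {rmorphism B -> T}),
     (forall a, k (i a) = k' (i a)) -> (forall x, X x -> k x = k' x) ->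
     forall b, k b = k' b).

(* Quillen's free maps: polynomial in each degree, on generators stable under
   the degeneracies.  Every cofibration of simplicial commutative algebras is a
   retract of a free map, and every map factors as a free map followed by a
   weak equivalence. *)
Definition free_map p (R Q : sAlg p) (i : sHom R Q) : Prop :=
  exists X : forall n, Q n -> Prop,
    (forall n, polynomial_on (i n) (X n)) /\
    (forall m n (a : Delta m n), surjective_map a ->
       forall x, X n x -> X m (act Q a x)).

(* P is the tensor product of B and C over A.  It is imposed in each degree
   below, since colimits of simplicial algebras are computed degreewise. *)
Definition ring_pushout (A B C P : comPzRingType)
    (f : {rmorphism A -> B}) (g : {rmorphism A -> C})
    (inl : {rmorphism B -> P}) (inr : {rmorphism C -> P}) : Prop :=
  (forall a, inl (f a) = inr (g a)) /\
  (forall (T : comPzRingType) (h : {rmorphism B -> T}) (k : {rmorphism C -> T}),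
     (forall a, h (f a) = k (g a)) ->
     exists2 u : {rmorphism P -> T},
       (forall b, u (inl b) = h b) /\ (forall c, u (inr c) = k c) &
       forall u' : {rmorphism P -> T},
         (forall b, u' (inl b) = h b) -> (forall c, u' (inr c) = k c) ->
         forall x, u' x = u x).

(* A model of the pushout of S <- R -> R' in animated algebras: replace R -> S
   by a free map R -> Q with a weak equivalence Q -> S, and take the strict
   pushout of Q <- R -> R'.  Up to equivalence it does not depend on Q. *)
Record derived_pushout p (R S R' : sAlg p) (f : sHom R S) (g : sHom R R') :=
  DerivedPushout {
    dp_res : sAlg p;
    dp_in : sHom R dp_res;
    dp_aug : sHom dp_res S;
    dp_free : free_map dp_in;
    dp_aug_equiv : equivalence dp_aug;
    dp_factor : sHom_eq (sHom_comp dp_aug dp_in) f;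
    dp_obj :> sAlg p;
    dp_inl : sHom dp_res dp_obj;
    dp_inr : sHom R' dp_obj;
    dp_pushout : forall n, ring_pushout (dp_in n) (g n) (dp_inl n) (dp_inr n)
  }.

(* The two equations determine [h], by the universal property of [D]. *)
Definition is_relative_frobenius p (p_pr : prime p) (R S : sAlg p)
    (f : sHom R S) (D : derived_pushout f (frobenius p_pr R)) (h : sHom D S) : Prop :=
  sHom_eq (sHom_comp h (dp_inl D)) (sHom_comp (frobenius p_pr S) (dp_aug D)) /\
  sHom_eq (sHom_comp h (dp_inr D)) f.

(* Since all derived pushouts are canonically equivalent under S and R, asking
   this for some [D] is the same as asking it for all of them. *)
Definition relatively_perfect p (p_pr : prime p) (R S : sAlg p) (f : sHom R S) : Prop :=
  exists (D : derived_pushout f (frobenius p_pr R)) (h : sHom D S),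
    is_relative_frobenius h /\ equivalence h.

(* Main.v *)
(* Let R -> Q be a free resolution of R -> S and let P be its base change along
   the Frobenius of R.  Being relatively perfect means that P -> Q, given by
   x |-> x^p on Q, is an equivalence, so that Q/R is generated up to boundaries
   by the p-th powers coming from P.  By induction on n suppose that Q/R has no
   homotopy below degree n > 0.  Since Q is free over R in each degree, Q is
   deformed over R, by ring morphisms, into the elements all of whose faces of
   dimension < n lie in R.  As ring morphisms commute with p-th powers, the
   deformation acts on P as well, and it follows that pi_n(Q/R) is spanned over R
   by the image of its Frobenius.  But the Frobenius kills pi_k(Q) and pi_k(R) for
   k > 0, and pi_0(R) -> pi_0(Q) is injective, so its square vanishes on
   pi_n(Q/R), whence pi_n(Q/R) = 0. *)

From HB Require Import structures.
From mathcomp Require Import all_boot all_order all_algebra.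
From mathcomp Require Import generic_quotient ring_quotient boolp zify.
Require Import Defs.

Set Implicit Arguments.
Unset Strict Implicit.
Unset Printing Implicit Defensive.

Import GRing.Theory.
Local Open Scope ring_scope.
Local Open Scope quotient_scope.

(** * Simplicial identities and horn filling *)

(* Junk for j > n, where the cut-off at n keeps the map monotone. *)
Lemma codegeneracy_subproof n (j : nat) :
  monotone [ffun v : 'I_n.+2 => inord (minn (unbump j v) n) : 'I_n.+1].
Proof.
apply/monotoneP => v w vw; rewrite !ffunE !inordK ?ltnS ?geq_minr //.
by rewrite /unbump; lia.
Qed.

Definition codegeneracy n (j : nat) : Delta n.+1 n :=
  Sub _ (codegeneracy_subproof n j).

Section SimplicialIdentities.
Variables (p : nat) (A : sAlg p).

Definition dface n (i : nat) : {rmorphism A n.+1 -> A n} := face A (inord i).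
Definition degen n (j : nat) : {rmorphism A n -> A n.+1} := act A (codegeneracy n j).

Lemma dfaceD n i (x y : A n.+1) : dface n i (x + y) = dface n i x + dface n i y.
Proof. exact: rmorphD. Qed.

Lemma dfaceB n i (x y : A n.+1) : dface n i (x - y) = dface n i x - dface n i y.
Proof. exact: rmorphB. Qed.

Lemma degen0 n j : degen n j 0 = 0.
Proof. exact: rmorph0. Qed.

Lemma degen_deg0 j (x : A 0%N) : degen 0 j x = degen 0 0 x.
Proof.
congr (act A _ x); apply/val_inj/ffunP => v; rewrite !ffunE.
by rewrite !minn0.
Qed.

(** Reduces each simplicial identity to an identity between [bump] and [unbump]. *)
Lemma act2_eq k m m' n (a : Delta k m) (b : Delta m n) (a' : Delta k m')
    (b' : Delta m' n) (x : A n) :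
  (forall i, val b (val a i) = val b' (val a' i) :> nat) ->
  act A a (act A b x) = act A a' (act A b' x).
Proof.
move=> e; rewrite -!act_comp; congr (act A _ x).
by apply/val_inj/ffunP => i; rewrite !ffunE; apply: val_inj; apply: e.
Qed.

Lemma coface_val n (i : nat) v :
  (i <= n.+1)%N -> val (coface (inord i : 'I_n.+2)) v = bump i v :> nat.
Proof. by move=> le_i; rewrite ffunE /= inordK. Qed.

Lemma codegeneracy_val n (j : nat) v :
  (j <= n)%N -> val (codegeneracy n j) v = unbump j v :> nat.
Proof.
move=> le_j; rewrite ffunE inordK ?ltnS ?geq_minr //.
by apply/minn_idPl; case: v => v lt_v; rewrite /unbump /=; lia.
Qed.

Lemma dface_dface n i j (x : A n.+2) :
  (i < j <= n.+2)%N -> dface n i (dface n.+1 j x) = dface n j.-1 (dface n.+1 i x).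
Proof.
move=> /andP[ij jn]; apply: act2_eq => v; rewrite !coface_val; try lia.
by rewrite /bump; lia.
Qed.

Lemma act_id_eq n m (a : Delta n m) (b : Delta m n) (x : A n) :
  (forall i, val b (val a i) = i :> nat) -> act A a (act A b x) = x.
Proof.
move=> e; rewrite -act_comp -[RHS]act_id; congr (act A _ x).
by apply/val_inj/ffunP => i; rewrite !ffunE; apply: val_inj; apply: e.
Qed.

Lemma dface_degen n j (x : A n) : (j <= n)%N -> dface n j (degen n j x) = x.
Proof.
move=> jn; apply: act_id_eq => v; rewrite codegeneracy_val // coface_val; last lia.
by rewrite /bump /unbump; lia.
Qed.

Lemma dfaceS_degen n j (x : A n) : (j <= n)%N -> dface n j.+1 (degen n j x) = x.
Proof.
move=> jn; apply: act_id_eq => v; rewrite codegeneracy_val // coface_val; last lia.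
by rewrite /bump /unbump; lia.
Qed.

Lemma dface_degen_lt n i j (x : A n.+1) :
  (i < j <= n.+1)%N -> dface n.+1 i (degen n.+1 j x) = degen n j.-1 (dface n i x).
Proof.
move=> /andP[ij jn]; apply: act2_eq => v.
rewrite codegeneracy_val // coface_val; last lia.
rewrite coface_val; last lia; rewrite codegeneracy_val; last lia.
by rewrite /bump /unbump; lia.
Qed.

Lemma dface_degen_gt n i j (x : A n.+1) :
  (j.+1 < i <= n.+2)%N -> dface n.+1 i (degen n.+1 j x) = degen n j (dface n i.-1 x).
Proof.
move=> /andP[ij jn]; apply: act2_eq => v.
rewrite codegeneracy_val; last lia; rewrite coface_val; last lia.
rewrite coface_val; last lia; rewrite codegeneracy_val; last lia.
by rewrite /bump /unbump; lia.
Qed.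

End SimplicialIdentities.

Local Notation "''d_' k" := (dface _ _ k) (at level 8, k at level 2, format "''d_' k").
Local Notation "''s_' k" := (degen _ _ k) (at level 8, k at level 2, format "''s_' k").

Lemma is_boundaryE p (A : sAlg p) n (x : A n) :
  is_boundary x <->
  exists2 y : A n.+1, 'd_0 y = x & forall k, (0 < k <= n.+1)%N -> 'd_k y = 0.
Proof.
have o0 : inord 0 = ord0 :> 'I_n.+2 by apply: val_inj; rewrite /= inordK.
split=> [] [y yx y0]; exists y; rewrite -?yx /dface ?o0 //.
  by move=> k /andP[k0 kn]; apply: y0; rewrite -val_eqE /= inordK // -lt0n.
move=> k k0; have := y0 k; rewrite /dface inord_val; apply.
by rewrite lt0n -ltnS ltn_ord andbT; move: k0; rewrite -val_eqE.
Qed.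

Lemma is_cycleE p (A : sAlg p) n (x : A n.+1) :
  is_cycle x <-> forall k, (k <= n.+1)%N -> 'd_k x = 0.
Proof.
split=> /= cx k; first by move=> _; apply: cx.
by have := cx k; rewrite /dface inord_val; apply; rewrite -ltnS ltn_ord.
Qed.

Section Functoriality.
Variables (p : nat) (R Q : sAlg p) (i : sHom R Q).

Lemma sHom_dface n k (r : R n.+1) : 'd_k (i _ r) = i _ ('d_k r).
Proof. by rewrite /dface /face sHom_act. Qed.

Lemma sHom_degen n k (r : R n) : 's_k (i _ r) = i _ ('s_k r).
Proof. by rewrite /degen sHom_act. Qed.

End Functoriality.

#[local] Opaque dface degen.

(* Horns are filled one face at a time: the correction of face l is the
   degeneracy of the error along the codegeneracy moving l towards m. *)
Lemma kan_horn p (A : sAlg p) n m (x : nat -> A n.+1) : (m <= n.+2)%N ->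
  (forall i j, (i < j <= n.+2)%N -> i != m -> j != m ->
     'd_i (x j) = 'd_j.-1 (x i)) ->
  exists y, forall i, (i <= n.+2)%N -> i != m -> 'd_i y = x i.
Proof.
move=> le_m xx.
have below l : (l <= m)%N -> exists y, forall i, (i < l)%N -> 'd_i y = x i.
  elim: l => [|l IH] lm; first by exists 0.
  case: IH => [|y Hy]; first lia.
  exists (y + 's_l (x l - 'd_l y)) => i il; rewrite dfaceD.
  have [->|ne] := eqVneq i l; first by rewrite dface_degen; [rewrite addrC subrK | lia].
  rewrite Hy ?dface_degen_lt; [|lia|lia].
  by rewrite dfaceB xx ?(dface_dface (i := i) (j := l)) ?(Hy i) ?subrr ?degen0 ?addr0
    //; lia.
(* Above [m] the order is reversed: a correction in the image of ['s_k.-1] keeps the faces below [m]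
   and above [k], because the matching conditions make the relevant faces of the error zero. *)
have above l : (l <= n.+2 - m)%N -> exists y, forall i, (i <= n.+2)%N ->
    (i < m)%N || (n.+2 - l < i)%N -> 'd_i y = x i.
  elim: l => [|l IH] lm.
    by case: (below m) => // y Hy; exists y => i ? ?; apply: Hy; lia.
  case: IH => [|y Hy]; first lia.
  pose k := (n.+2 - l)%N; have kE : k = k.-1.+1 by rewrite /k; lia.
  exists (y + 's_k.-1 (x k - 'd_k y)) => i il im; rewrite dfaceD.
  have [->|ne] := eqVneq i k.
    have -> (z : A n.+1) : 'd_k ('s_k.-1 z) = z by rewrite {1}kE dfaceS_degen //; lia.
    by rewrite addrC subrK.
  rewrite Hy; [|lia|lia]; case/orP: im => im.
    rewrite dface_degen_lt; last lia.
    by rewrite dfaceB xx ?(dface_dface (i := i) (j := k)) ?(Hy i) ?subrr ?degen0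
      ?addr0 //; lia.
  rewrite dface_degen_gt; last lia.
  by rewrite dfaceB -(dface_dface (i := k)) -?(xx k) ?(Hy i) ?subrr ?degen0 ?addr0
    //; lia.
case: (above (n.+2 - m)%N) => // y Hy; exists y => i le_i ne.
by apply: Hy => //; lia.
Qed.

(** * Cycles and boundaries relative to a subalgebra *)

Section Relative.
Variables (p : nat) (R Q : sAlg p) (i : sHom R Q).
Hypothesis i_inj : forall n, injective (i n).

Definition inR n (x : Q n) : Prop := exists r, x = i n r.

Lemma inRi n r : inR (i n r).
Proof. by exists r. Qed.

Lemma inR0 n : inR (0 : Q n).
Proof. by exists 0; rewrite rmorph0. Qed.

Lemma inR1 n : inR (1 : Q n).
Proof. by exists 1; rewrite rmorph1. Qed.

Lemma inRD n (x y : Q n) : inR x -> inR y -> inR (x + y).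
Proof. by move=> [a ->] [b ->]; exists (a + b); rewrite rmorphD. Qed.

Lemma inRN n (x : Q n) : inR x -> inR (- x).
Proof. by move=> [a ->]; exists (- a); rewrite rmorphN. Qed.

Lemma inRB n (x y : Q n) : inR x -> inR y -> inR (x - y).
Proof. by move=> hx /inRN; apply: inRD. Qed.

Lemma inRM n (x y : Q n) : inR x -> inR y -> inR (x * y).
Proof. by move=> [a ->] [b ->]; exists (a * b); rewrite rmorphM. Qed.

Lemma inR_dface n k (x : Q n.+1) : inR x -> inR ('d_k x).
Proof. by move=> [a ->]; rewrite sHom_dface; apply: inRi. Qed.

Lemma inR_degen n k (x : Q n) : inR x -> inR ('s_k x).
Proof. by move=> [a ->]; rewrite sHom_degen; apply: inRi. Qed.

(** With [rel_boundary], this describes the homology of [Q]/[R] by elements of [Q], so that products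
    and [p]-th powers remain available. *)
Definition rel_cycle n : Q n -> Prop :=
  if n is n'.+1 then fun x : Q n'.+1 => forall k, (k <= n)%N -> inR ('d_k x)
  else fun=> True.

Definition rel_boundary n (x : Q n) : Prop := exists r, is_boundary (x - i n r).

(** By injectivity of [i], these faces of [y] match already in [R] and form a horn that is filled
    there. *)
Lemma kan_inR n (y : Q n.+1) :
  (forall k, (0 < k <= n.+1)%N -> inR ('d_k y)) ->
  exists e : R n.+1, forall k, (0 < k <= n.+1)%N -> 'd_k y = i _ ('d_k e).
Proof.
case: n y => [|n] y yR.
  have [//|r yr] := yR 1%N; exists ('s_0 r) => k k01.
  by rewrite (_ : k = 1%N) ?yr ?dfaceS_degen //; lia.
have {}yR k : exists r, (0 < k <= n.+2)%N -> 'd_k y = i _ r.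
  by have [/yR[r ->]|] := boolP (0 < k <= n.+2)%N; [exists r | exists 0].
have [r yr] := choice yR.
have [//|j k /andP[jk kn] j0 k0|e er] := @kan_horn p R n 0 r.
  apply: i_inj; rewrite -!sHom_dface -!yr; try lia.
  by rewrite dface_dface //; lia.
by exists e => k kn; rewrite er ?yr //; lia.
Qed.

Lemma boundaryD n (x y : Q n) :
  is_boundary x -> is_boundary y -> is_boundary (x + y).
Proof.
move=> [a <- a0] [b <- b0]; exists (a + b); first by rewrite rmorphD.
by move=> k k0; rewrite rmorphD a0 // b0 // addr0.
Qed.

Lemma boundaryN n (x : Q n) : is_boundary x -> is_boundary (- x).
Proof.
move=> [a <- a0]; exists (- a); first by rewrite rmorphN.
by move=> k k0; rewrite rmorphN a0 // oppr0.
Qed.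

Lemma boundaryM n (z x : Q n) : is_boundary x -> is_boundary (z * x).
Proof.
move/is_boundaryE => [a <- a0]; apply/is_boundaryE; exists ('s_0 z * a).
  by rewrite rmorphM dface_degen.
by move=> k k0; rewrite rmorphM a0 // mulr0.
Qed.

Lemma rel_boundary_inR n (x : Q n) : inR x -> rel_boundary x.
Proof.
by move=> [r ->]; exists r; rewrite subrr; exists 0 => *; rewrite rmorph0.
Qed.

Lemma rel_boundaryD n (x y : Q n) :
  rel_boundary x -> rel_boundary y -> rel_boundary (x + y).
Proof.
move=> [a ax] [b bx]; exists (a + b); rewrite rmorphD opprD addrACA.
exact: boundaryD.
Qed.

Lemma rel_boundaryN n (x : Q n) : rel_boundary x -> rel_boundary (- x).
Proof.
by move=> [a /boundaryN ax]; exists (- a); rewrite rmorphN -opprD.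
Qed.

Lemma rel_boundaryZ n r (x : Q n) : rel_boundary x -> rel_boundary (i n r * x).
Proof.
by move=> [a /(boundaryM (i n r)) ax]; exists (r * a); rewrite rmorphM -mulrBr.
Qed.

Lemma rel_boundary_face0 n (y : Q n.+1) :
  (forall k, (0 < k <= n.+1)%N -> inR ('d_k y)) -> rel_boundary ('d_0 y).
Proof.
move=> /kan_inR[e ye]; exists ('d_0 e); apply/is_boundaryE.
exists (y - i _ e) => [|k kn]; first by rewrite dfaceB sHom_dface.
by rewrite dfaceB ye // sHom_dface subrr.
Qed.

(** Induction moves the exceptional face down: ['s_j c - y] has zero face [j.+1], and its face [j]
    is [c] up to an element of [R]. *)
Lemma rel_boundary_face n j (y : Q n.+1) : (j <= n.+1)%N ->
  (forall k, (k <= n.+1)%N -> k != j -> inR ('d_k y)) -> rel_boundary ('d_j y).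
Proof.
elim: j y => [|j IH] y jn yR.
  by apply: rel_boundary_face0 => k /andP[k0 kn]; apply: yR; lia.
move cE : ('d_j.+1 y) => c.
have -> : c = 'd_j ('s_j c - y) + 'd_j y by rewrite dfaceB dface_degen ?subrK //; lia.
apply: rel_boundaryD; last by apply/rel_boundary_inR/yR; lia.
apply: IH => [|k kn kj]; first lia.
rewrite dfaceB; have [->|kj1] := eqVneq k j.+1.
  by rewrite dfaceS_degen; [rewrite cE subrr; apply: inR0 | lia].
apply: inRB; last exact: yR.
case: n y c cE jn yR kn => [|n] y c cE jn yR kn; first lia.
have [lt_kj|le_jk] := ltnP k j.
  rewrite dface_degen_lt; last lia.
  by rewrite -cE dface_dface; [apply/inR_degen/inR_dface/yR; lia | lia].
rewrite dface_degen_gt; last lia.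
have -> : 'd_k.-1 c = 'd_j.+1 ('d_k y) by rewrite -cE [RHS]dface_dface //; lia.
by apply/inR_degen/inR_dface/yR; lia.
Qed.

(** Subtracting ['s_j v] annihilates face [j.+1] and leaves the difference as the only face that may
    lie outside [R]. *)
Lemma rel_boundary_move n j (y : Q n.+1) : (j <= n)%N ->
  (forall k, (k <= n.+1)%N -> k != j -> k != j.+1 -> inR ('d_k y)) ->
  rel_boundary ('d_j y - 'd_j.+1 y).
Proof.
move=> jn yR; move vE : ('d_j.+1 y) => v.
have -> : 'd_j y - v = 'd_j (y - 's_j v) by rewrite dfaceB dface_degen.
apply: rel_boundary_face => [|k kn kj]; first lia.
rewrite dfaceB; have [->|kj1] := eqVneq k j.+1.
  by rewrite dfaceS_degen // vE subrr; apply: inR0.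
apply: inRB; first exact: yR.
case: n y v vE jn yR kn => [|n] y v vE jn yR kn; first lia.
have [lt_kj|le_jk] := ltnP k j.
  rewrite dface_degen_lt; last lia.
  by rewrite -vE dface_dface; [apply/inR_degen/inR_dface/yR; lia | lia].
rewrite dface_degen_gt; last lia.
have -> : 'd_k.-1 v = 'd_j.+1 ('d_k y) by rewrite -vE [RHS]dface_dface //; lia.
by apply/inR_degen/inR_dface/yR; lia.
Qed.

End Relative.

(** * Subrings and universal properties *)

Section Subring.
Variables (T : comPzRingType) (J : T -> Prop).
Hypotheses (J1 : J 1) (JB : forall x y, J x -> J y -> J (x - y))
  (JM : forall x y, J x -> J y -> J (x * y)).

Definition subring_pred of J 1 & (forall x y, J x -> J y -> J (x - y)) &
  (forall x y, J x -> J y -> J (x * y)) : {pred T} := fun x => `[< J x >].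
Local Notation JP := (subring_pred J1 JB JM).

Lemma subring_pred_closed : subring_closed JP.
Proof.
split; rewrite ?unfold_in; first exact/asboolP.
  by move=> x y; rewrite !unfold_in => /asboolP ? /asboolP ?; apply/asboolP/JB.
by move=> x y; rewrite !unfold_in => /asboolP ? /asboolP ?; apply/asboolP/JM.
Qed.

Record subring := Subring { subring_val : T; _ : subring_val \in JP }.
HB.instance Definition _ := [isSub for subring_val].
HB.instance Definition _ := [Choice of subring by <:].
HB.instance Definition _ :=
  GRing.SubChoice_isSubComPzRing.Build T JP subring subring_pred_closed.

Section Corestriction.
Variables (B : comPzRingType) (g : {rmorphism B -> T}).
Hypothesis gJ : forall b, J (g b).

Fact subring_lift_subproof b : g b \in JP.
Proof. by rewrite unfold_in; apply/asboolP. Qed.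

Definition subring_lift b : subring := Subring (subring_lift_subproof b).

Fact subring_lift_nmod : nmod_morphism subring_lift.
Proof.
by split=> [|x y]; apply: val_inj; rewrite /= ?rmorph0 ?rmorphD.
Qed.

Fact subring_lift_monoid : monoid_morphism subring_lift.
Proof.
by split=> [|x y]; apply: val_inj; rewrite /= ?rmorph1 ?rmorphM.
Qed.

HB.instance Definition _ :=
  GRing.isNmodMorphism.Build B subring subring_lift subring_lift_nmod.
HB.instance Definition _ :=
  GRing.isMonoidMorphism.Build B subring subring_lift subring_lift_monoid.

End Corestriction.

Lemma subring_valP (u : subring) : J (val u).
Proof. by case: u => x /=; rewrite unfold_in => /asboolP. Qed.

(** Existence in the universal property gives a morphism into the subring; uniqueness identifies it
    with [g]. *)
Lemma polynomial_on_subring (A B : comPzRingType) (i : {rmorphism A -> B})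
    (X : B -> Prop) (g : {rmorphism B -> T}) :
  polynomial_on i X -> (forall a, J (g (i a))) -> (forall x, X x -> J (g x)) ->
  forall b, J (g b).
Proof.
move=> [ex un] Ji JX b.
(* The default [0] is never met on [X], where [g x] lies in [J]. *)
pose v x : subring := insubd 0 (g x).
have [k [ki kX]] := ex _ (subring_lift (g := g \o i) Ji) v.
rewrite (un _ g (val \o k)) => [|a|x xX] /=; first exact: subring_valP.
  by rewrite ki.
by rewrite kX // val_insubd /= unfold_in (asboolT (JX x xX)).
Qed.

Lemma ring_pushout_subring (A B C P : comPzRingType)
    (f : {rmorphism A -> B}) (g : {rmorphism A -> C})
    (inl : {rmorphism B -> P}) (inr : {rmorphism C -> P})
    (h : {rmorphism P -> T}) :
  ring_pushout f g inl inr -> (forall b, J (h (inl b))) ->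
  (forall c, J (h (inr c))) -> forall x, J (h x).
Proof.
move=> [fg univ] Jl Jr x.
have [|k [kl kr] _] := univ _ (subring_lift (g := h \o inl) Jl)
  (subring_lift (g := h \o inr) Jr).
  by move=> a; apply: val_inj; rewrite /= fg.
have [|h' _ h'u] := univ _ (h \o inl) (h \o inr); first by move=> a; rewrite /= fg.
rewrite (h'u h) // -(h'u (val \o k)) /=; first exact: subring_valP.
  by move=> b; rewrite kl.
by move=> c; rewrite kr.
Qed.

End Subring.

(** * Compressing a free extension onto its base *)

Section Prisms.
Variables (p : nat) (R Q : sAlg p) (i : sHom R Q).
Variable X : forall n, Q n -> Prop.
Hypothesis poly : forall n, polynomial_on (i n) (@X n).
Variable N : nat.
Hypothesis acyclic : forall n, (n < N)%N ->
  forall x : Q n, rel_cycle i x -> rel_boundary i x.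

Lemma poly_ext n (T : comPzRingType) (g h : {rmorphism Q n -> T}) :
  (forall r, g (i n r) = h (i n r)) -> (forall x, X x -> g x = h x) ->
  forall x, g x = h x.
Proof. by case: (poly n) => _; apply. Qed.

(* Degree k of a simplicial homotopy under R from a map retracting Q into R in
   degrees below N to the identity, through the maps 'd_j \o H j. *)
Record prisms k (H : nat -> {rmorphism Q k -> Q k.+1}) : Prop := Prisms {
  prisms_in : forall j r, H j (i k r) = i k.+1 ('s_j r);
  prisms_last : forall x, 'd_k.+1 (H k x) = x;
  prisms_mid : forall j x, (j < k)%N -> 'd_j.+1 (H j x) = 'd_j.+1 (H j.+1 x);
  prisms_0 : (k < N)%N -> forall x, inR i ('d_0 (H 0%N x))
}.

(** The face [a] that the identities of a simplicial homotopy dictate for prism [j] over [x], when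
    [a] is neither [j] nor [j.+1]. *)
Definition prism_face k (H : nat -> {rmorphism Q k -> Q k.+1}) j a (x : Q k.+1) :
  Q k.+1 := if (a < j)%N then H j.-1 ('d_a x) else H j ('d_a.-1 x).

(* Only faces enter: as a semi-simplicial algebra, Q is freely generated over R
   by all of the X n, so that the H can be chosen generator by generator. *)
Definition compatible k (H : nat -> {rmorphism Q k -> Q k.+1})
    (H' : nat -> {rmorphism Q k.+1 -> Q k.+2}) : Prop :=
  forall j a x, (j <= k.+1)%N -> (a <= k.+2)%N -> a != j -> a != j.+1 ->
    'd_a (H' j x) = prism_face H j a x.

Definition matching k (H : nat -> {rmorphism Q k -> Q k.+1}) : Prop :=
  forall j a b x, (j <= k.+1)%N -> (a < b <= k.+2)%N ->
    a != j -> a != j.+1 -> b != j -> b != j.+1 ->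
    'd_a (prism_face H j b x) = 'd_b.-1 (prism_face H j a x).

(** Compatibility turns both sides into values of [H] at double faces of [x], where [dface_dface]
    applies. *)
Lemma compatible_matching k H H' : @compatible k H H' -> matching H'.
Proof.
move=> HH j a b x jk /andP[ab bk] aj aj1 bj bj1; rewrite /prism_face.
have [bltj|jleb] := ltnP b j.
  have [altj|?] := ltnP a j; last lia.
  rewrite !HH /prism_face; try lia.
  have [-> ->] : (a < j.-1)%N /\ (b.-1 < j.-1)%N by lia.
  by rewrite dface_dface //; lia.
have [altj|jlea] := ltnP a j.
  rewrite !HH /prism_face; try lia.
  have [-> ->] : (a < j)%N /\ (b.-1 < j.-1)%N = false by lia.
  by rewrite dface_dface //; lia.
rewrite !HH /prism_face; try lia.
have [-> ->] : (a < j)%N = false /\ (b.-1 < j)%N = false by lia.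
by rewrite dface_dface //; lia.
Qed.

(** * Extending the homotopy by one degree *)

Section Filling.
Variables (k : nat) (H : nat -> {rmorphism Q k -> Q k.+1}).
Hypotheses (HP : prisms H) (HM : matching H).

(** The stages of the homotopy: stage [0] is the compression, stage [k.+1] the identity, and the
    stages between are the common walls of consecutive prisms. *)
Definition prism_map j (y : Q k) : Q k :=
  if j is j'.+1 then 'd_j (H j' y) else 'd_0 (H 0%N y).

Lemma prism_mapE j y : (j <= k)%N -> 'd_j (H j y) = prism_map j y.
Proof. by case: j => [|j] //= jk; rewrite prisms_mid. Qed.

Lemma prism_map_pred j y : (0 < j)%N -> 'd_j (H j.-1 y) = prism_map j y.
Proof. by case: j. Qed.

Definition right_faces (x t : Q k.+1) j : Prop := forall a, (a <= k.+1)%N ->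
  'd_a t = prism_map (if (a < j)%N then j.-1 else j) ('d_a x).

(** The wall [t] and the dictated faces form a horn missing only face [j]; its filler supplies the
    next wall. *)
Lemma prism_step x t j : (j <= k.+1)%N -> right_faces x t j.+1 ->
  exists h : Q k.+2,
    [/\ 'd_j.+1 h = t,
        forall a, (a <= k.+2)%N -> a != j -> a != j.+1 ->
          'd_a h = prism_face H j a x
      & right_faces x ('d_j h) j].
Proof.
move=> jk tx.
have [||h hx] := @kan_horn p Q k j
  (fun a => if a == j.+1 then t else prism_face H j a x).
- lia.
- move=> a b /andP[ab bk] aj bj.
  have [bE|bj1] := eqVneq b j.+1.
    have -> : (a == j.+1) = false by lia.
    rewrite bE tx; last lia.
    have [e1 e2] : (a < j.+1)%N /\ (a < j)%N by lia.
    by rewrite /prism_face e1 e2 prism_map_pred //; lia.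
  have [aE|aj1] := eqVneq a j.+1; last by apply: HM => //; lia.
  rewrite aE tx /prism_face; last lia.
  have -> : (b < j)%N = false by lia.
  by have -> : (b.-1 < j.+1)%N = false by lia.
have hx' a : (a <= k.+2)%N -> a != j -> a != j.+1 ->
    'd_a h = prism_face H j a x.
  by move=> ak aj aj1; rewrite hx // (negbTE aj1).
have hj : 'd_j.+1 h = t by rewrite hx ?eqxx //; lia.
exists h; split=> // a ak; have [alt|] := ltnP a j.
  rewrite dface_dface; last lia; rewrite hx'; try lia.
  rewrite /prism_face alt prism_mapE //; lia.
rewrite leq_eqVlt => /orP[/eqP <-|lt_ja].
  rewrite -(dface_dface (j := j.+1)); last lia; rewrite hj tx; last lia.
  by rewrite ltnSn.
rewrite -(dface_dface (j := a.+1)); last lia; rewrite hx'; try lia.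
rewrite /prism_face; have -> : (a.+1 < j)%N = false by lia.
by rewrite prism_mapE //; lia.
Qed.

Lemma prism_fill (x : Q k.+1) : exists h : nat -> Q k.+2,
  [/\ forall j a, (j <= k.+1)%N -> (a <= k.+2)%N -> a != j -> a != j.+1 ->
        'd_a (h j) = prism_face H j a x,
      'd_k.+2 (h k.+1) = x,
      forall j, (j <= k)%N -> 'd_j.+1 (h j) = 'd_j.+1 (h j.+1)
    & (k.+1 < N)%N -> inR i ('d_0 (h 0%N))].
Proof.
(* The top wall, at stage [k.+2], is [x] itself; the filling descends from there to stage [0]. *)
pose edge (h : nat -> Q k.+2) m := if m == k.+2 then x else 'd_m (h m).
have fill l : (l <= k.+2)%N -> exists h, right_faces x (edge h (k.+2 - l)%N) (k.+2 - l)
   /\ forall j, (k.+2 - l <= j <= k.+1)%N -> 'd_j.+1 (h j) = edge h j.+1 /\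
    forall a, (a <= k.+2)%N -> a != j -> a != j.+1 ->
      'd_a (h j) = prism_face H j a x.
  elim: l => [|l IH] lk.
    exists (fun=> 0); rewrite subn0 /edge eqxx; split; last lia.
    by move=> a ak; rewrite ltnS ak /= prisms_last.
  case: IH => [|h]; first lia; set m := (k.+2 - l.+1)%N.
  have -> : (k.+2 - l = m.+1)%N by rewrite /m; lia.
  have mk : (m <= k.+1)%N by rewrite /m; lia.
  move=> [/(prism_step mk)[g [gt gx gr]] hx].
  exists (fun j => if j == m then g else h j); split.
    by rewrite /edge eqxx; have -> : (m == k.+2) = false by lia.
  move=> j /andP[mj jk]; rewrite /edge.
  have -> : (j.+1 == m) = false by lia.
  have [->//|jm] := eqVneq j m.
  by apply: hx; lia.
have [//|h] := fill k.+2; rewrite subnn => -[h0 hx].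
have hE j : (j <= k)%N -> 'd_j.+1 (h j) = 'd_j.+1 (h j.+1).
  move=> jk; case: (hx j) => [|-> _]; first lia.
  by rewrite /edge; have -> : (j.+1 == k.+2) = false by lia.
have hlast : 'd_k.+2 (h k.+1) = x.
  by case: (hx k.+1) => [|-> _]; [lia | rewrite /edge eqxx].
have [kN|kN] := boolP (k.+1 < N)%N; last first.
  by exists h; split=> // j a jk; case: (hx j) => // _; apply.
(* The bottom wall is a relative cycle, since its faces are already compressed. Acyclicity makes it
   an element of [R] plus ['d_0 y]; subtracting [y] from prism [0] removes that boundary and alters
   no other face. *)
have [|r /is_boundaryE[y y0 yk]] := @acyclic _ kN (edge h 0%N).
  by move=> a ak; rewrite h0 //=; apply: (prisms_0 HP); lia.
have hy j a : (a <= k.+2)%N -> a != j -> 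
    'd_a (h j - (if j == 0%N then y else 0)) = 'd_a (h j).
  rewrite dfaceB; have [->|j0] := eqVneq j 0%N => ak aj; last by rewrite rmorph0 subr0.
  by rewrite yk ?subr0 //; lia.
exists (fun j => h j - (if j == 0%N then y else 0)); split.
- by move=> j a jk ak aj aj1; rewrite hy //; case: (hx j) => // _; apply.
- by rewrite hy //; lia.
- move=> j jk; rewrite hy ?hE ?subr0 //; lia.
- move=> _; rewrite dfaceB y0 /edge /= opprB addrC subrK; exact: inRi.
Qed.

(** The fillers need not be multiplicative in [x]. Freeness keeps only their values on generators,
    and each identity between ring morphisms is then checked on [R] and on [X]. *)
Lemma prisms_next : exists2 H', prisms H' & compatible H H'.
Proof.
have [h hP] := choice prism_fill.
have /choice[H' H'P] j : exists g : {rmorphism Q k.+1 -> Q k.+2},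
    (forall r, g (i _ r) = i _ ('s_j r)) /\ (forall x, X x -> g x = h x j).
  case: (poly k.+1) => ex _.
  exact: (ex _ (i k.+2 \o degen R k.+1 j) (fun x => h x j)).
have H'i j r : H' j (i _ r) = i _ ('s_j r) by case: (H'P j).
have H'X j x : X x -> H' j x = h x j by case: (H'P j) => _; apply.
exists H'; first split=> //.
- apply: (@poly_ext _ _ (dface Q _ k.+2 \o H' k.+1) idfun) => /= [r|x xX].
    by rewrite H'i sHom_dface dfaceS_degen.
  by rewrite H'X //; case: (hP x).
- move=> j x jk; move: x.
  apply: (@poly_ext _ _ (dface Q _ j.+1 \o H' j)
    (dface Q _ j.+1 \o H' j.+1)) => /= [r|x xX].
    by rewrite !H'i !sHom_dface dfaceS_degen ?dface_degen //; lia.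
  by rewrite !H'X //; case: (hP x) => _ _ + _; apply; lia.
- move=> kN; pose e : {rmorphism Q k.+1 -> Q k.+1} := dface Q _ 0 \o H' 0%N.
  apply: (polynomial_on_subring (J := @inR _ _ _ i k.+1) (g := e) _ _ _ (poly k.+1)).
  + exact: inR1.
  + exact: inRB.
  + exact: inRM.
  + by move=> r; rewrite /e /= H'i sHom_dface; apply: inRi.
  + by move=> x xX; rewrite /e /= H'X //; case: (hP x) => _ _ _; apply.
move=> j a x jk ak aj aj1; move: x; rewrite /prism_face.
have [altj|lea] := ltnP a j.
  apply: (@poly_ext _ _ (dface Q _ a \o H' j) (H j.-1 \o dface Q _ a)) => /= [r|x xX].
    by rewrite H'i !sHom_dface (prisms_in HP) dface_degen_lt //; lia.
  by rewrite H'X //; case: (hP x) => hf _ _ _; rewrite hf // /prism_face altj.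
apply: (@poly_ext _ _ (dface Q _ a \o H' j) (H j \o dface Q _ a.-1)) => /= [r|x xX].
  by rewrite H'i !sHom_dface (prisms_in HP) dface_degen_gt //; lia.
by rewrite H'X //; case: (hP x) => hf _ _ _; rewrite hf // /prism_face ltnNge lea.
Qed.

End Filling.

Lemma prisms0 : exists2 H, prisms H & @matching 0 H.
Proof.
have /choice[h hP] (x : Q 0%N) : exists y : Q 1%N,
    'd_1 y = x /\ ((0 < N)%N -> inR i ('d_0 y)).
  have [N0|N0] := boolP (0 < N)%N; last first.
    by exists ('s_0 x); rewrite dfaceS_degen.
  have [//|r /is_boundaryE[y y0 yk]] := @acyclic _ N0 x.
  (* Since ['d_0 y] is [x - i r], the new face [0] is [i r]. *)
  exists ('s_0 x - y).
  rewrite !dfaceB dfaceS_degen // yk // subr0 dface_degen // y0.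
  split=> // _.
  by rewrite opprB addrC subrK; apply: inRi.
have [H [Hi HX]] : exists g : {rmorphism Q 0%N -> Q 1%N},
    (forall r, g (i _ r) = i _ ('s_0 r)) /\ (forall x, X x -> g x = h x).
  by case: (poly 0%N) => ex _; apply: (ex _ (i 1%N \o degen R 0%N 0) h).
(* A constant family suffices because all degeneracies out of degree [0] agree; matching is vacuous,
   as a prism here has a single dictated face. *)
exists (fun=> H); last by move=> j a b x; lia.
split=> [j r||j x //|N0].
- by rewrite Hi degen_deg0.
- apply: (@poly_ext _ _ (dface Q _ 1 \o H) idfun) => /= [r|x xX].
    by rewrite Hi sHom_dface dfaceS_degen.
  by rewrite HX //; case: (hP x).
- pose e : {rmorphism Q 0%N -> Q 0%N} := dface Q _ 0 \o H.
  apply: (polynomial_on_subring (J := @inR _ _ _ i 0) (g := e) _ _ _ (poly 0%N)).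
  + exact: inR1.
  + exact: inRB.
  + exact: inRM.
  + by move=> r; rewrite /e /= Hi sHom_dface; apply: inRi.
  + by move=> x xX; rewrite /e /= HX //; case: (hP x) => _; apply.
Qed.

(** The next horns match only by compatibility with the previous degree, so the induction carries
    two consecutive degrees. *)
Lemma prisms_exist k : exists H H', [/\ prisms H, prisms H' & @compatible k H H'].
Proof.
elim: k => [|k [H [H' [_ H'P HH']]]].
  have [H HP HM] := prisms0; have [H' H'P HH'] := prisms_next HP HM.
  by exists H, H'.
have [H'' H''P HH''] := prisms_next H'P (compatible_matching HH').
by exists H', H''.
Qed.

End Prisms.

(** Here [g] is the compressed end of the homotopy. Its faces lie in [R] because lower degrees are
    compressed into [R]; over a relative cycle the dictated faces of the prisms lie in [R], which
    makes the two ends homologous. *)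
Lemma rel_cycle_retract p (R Q : sAlg p) (i : sHom R Q)
    (X : forall n, Q n -> Prop) n :
  (forall n, injective (i n)) -> (forall n, polynomial_on (i n) (@X n)) ->
  (forall k, (k <= n)%N -> forall x : Q k, rel_cycle i x -> rel_boundary i x) ->
  exists g : {rmorphism Q n.+1 -> Q n.+1},
    [/\ forall r, g (i n.+1 r) = i n.+1 r,
        forall x, rel_cycle i (g x)
      & forall x, rel_cycle i x -> rel_boundary i (x - g x)].
Proof.
move=> i_inj poly acyclic.
have [H [H' [HP H'P HH]]] := prisms_exist (N := n.+1) poly acyclic n.
exists (dface Q _ 0 \o H' 0%N); split=> [r|x a an|x xZ] /=.
- by rewrite (prisms_in H'P) sHom_dface dface_degen.
- have [->|a0] := posnP a.
    (* Faces [0] and [1] of prism [0] are not dictated, so the computation crosses the common wall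
       into prism [1], whose face [0] is. *)
    rewrite -(dface_dface (j := 1%N)) // (prisms_mid H'P) // dface_dface // HH //.
    by rewrite /prism_face /=; apply: (prisms_0 HP).
  rewrite -(dface_dface (j := a.+1)); last lia; rewrite HH; try lia.
  by rewrite /prism_face /=; apply: (prisms_0 HP).
have vertical j : (j <= n.+1)%N ->
    rel_boundary i ('d_j.+1 (H' j x) - 'd_j (H' j x)).
  move=> jn; rewrite -opprB; apply: rel_boundaryN.
  apply: rel_boundary_move => // a an aj aj1.
  rewrite HH // /prism_face; case: ltnP => ?.
    have [|r ->] := xZ a; first lia.
    by rewrite (prisms_in HP); apply: inRi.
  have [|r ->] := xZ a.-1; first lia.
  by rewrite (prisms_in HP); apply: inRi.
have walk j : (j <= n.+1)%N ->
    rel_boundary i ('d_j.+1 (H' j x) - 'd_0 (H' 0%N x)); last first.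
  by rewrite -{1}(prisms_last H'P x); apply: walk.
elim: j => [|j IH] jn; first exact: vertical.
rewrite -[X in rel_boundary i X](subrKA ('d_j.+1 (H' j.+1 x))).
apply: rel_boundaryD; first exact: vertical.
by rewrite -(prisms_mid H'P) //; apply: IH; lia.
Qed.


(** * Homotopy groups in terms of elements *)

Section HomotopyMaps.
Variables (p : nat) (R S : sAlg p) (f : sHom R S).

Definition homotopy_class (A : sAlg p) n (x : cycles A n) : homotopy_group A n :=
  \pi_(Quotient.quot (@boundary_pred p A n)) x.

Lemma homotopy_classP (A : sAlg p) n (x y : cycles A n) :
  homotopy_class x = homotopy_class y <-> is_boundary (val x - val y).
Proof.
split=> [/eqP|xy]; last first.
  by apply/eqP; rewrite -Quotient.idealrBE unfold_in; apply/asboolP.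
by rewrite -Quotient.idealrBE unfold_in => /asboolP.
Qed.

Lemma H0_projE (A : sAlg p) (x y : A 0%N) :
  H0_proj x = H0_proj y <-> is_boundary (x - y).
Proof.
split; first by move/H0_projP; rewrite unfold_in => /asboolP.
by move=> xy; apply/H0_projP; rewrite unfold_in; apply/asboolP.
Qed.

Lemma surj_bijective (T U : Type) (g : T -> U) :
  injective g -> (forall u, exists t, g t = u) -> bijective g.
Proof.
by move=> g_inj /choice[g' gK]; exists g' => // t; apply: g_inj; rewrite gK.
Qed.

Lemma homotopy_map_bijP n : bijective (@homotopy_map p R S f n) <->
  (forall x, is_cycle x -> is_boundary (f n x) -> is_boundary x) /\
  (forall y, is_cycle y -> exists2 x, is_cycle x & is_boundary (f n x - y)).
Proof.
have cP (A : sAlg p) (x : A n) : is_cycle x -> x \in @cycle_pred p A n.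
  by rewrite unfold_in => /asboolT.
have cV (A : sAlg p) (x : cycles A n) : is_cycle (val x).
  by case: x => x /=; rewrite unfold_in => /asboolP.
split=> [[g fK gK]|[f_inj f_surj]].
  split=> [x cx fx|y cy].
    have /(congr1 g) : homotopy_map f (homotopy_class (Cycle (cP _ _ cx))) =
        homotopy_map f (homotopy_class (0 : cycles R n)).
      by rewrite !homotopy_map_pi; apply/homotopy_classP; rewrite /= rmorph0 subr0.
    by rewrite !fK => /homotopy_classP; rewrite /= subr0.
  set c := Cycle (cP _ _ cy); have := gK (homotopy_class c).
  rewrite -[g _]reprK [LHS]homotopy_map_pi => /homotopy_classP /= fy.
  by exists (val (repr (g (homotopy_class c)))).
apply: surj_bijective => [u v|u].
  rewrite -[u]reprK -[v]reprK !homotopy_map_pi => /homotopy_classP /= uv.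
  apply/homotopy_classP; rewrite -raddfB; apply: f_inj; first exact: cV.
  by rewrite raddfB rmorphB.
have [x cx fx] := f_surj _ (cV _ (repr u)).
exists (homotopy_class (Cycle (cP _ _ cx))); rewrite homotopy_map_pi -[RHS]reprK.
exact/homotopy_classP.
Qed.

Lemma equivalenceP : equivalence f <-> forall n,
  (forall x, is_cycle x -> is_boundary (f n x) -> is_boundary x) /\
  (forall y, is_cycle y -> exists2 x, is_cycle x & is_boundary (f n x - y)).
Proof. by split=> fE n; apply/homotopy_map_bijP. Qed.

Lemma H0_homP : ring_isomorphism (H0_hom f) <->
  (forall x, is_boundary (f 0%N x) -> is_boundary x) /\
  (forall y, exists x, is_boundary (f 0%N x - y)).
Proof.
split=> [[g fK gK]|[f_inj f_surj]].
  split=> [x fx|y].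
    have /(congr1 g) : H0_hom f (H0_proj x) = H0_hom f (H0_proj 0).
      by rewrite /= !H0_map_proj; apply/H0_projE; rewrite rmorph0 subr0.
    by rewrite !fK => /H0_projE; rewrite subr0.
  have := gK (H0_proj y); rewrite -[g _]H0_projK /= H0_map_proj => /H0_projE fy.
  by eexists; exact: fy.
apply: surj_bijective => [u v|u].
  rewrite -[u]H0_projK -[v]H0_projK /= !H0_map_proj => /H0_projE.
  by rewrite -rmorphB => /f_inj uv; apply/H0_projE.
have [x fx] := f_surj (repr u).
by exists (H0_proj x); rewrite /= H0_map_proj -[RHS]H0_projK; apply/H0_projE.
Qed.

End HomotopyMaps.

(** * The Frobenius on homotopy *)

(* Eckmann-Hilton: the faces of 's_0 x * 's_1 y are zero except for 'd_1, which
   is x * y; subtracting 's_0 (x * y) moves it to 'd_0. *)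
Lemma boundary_cycleM p (A : sAlg p) n (x y : A n.+1) :
  is_cycle x -> is_cycle y -> is_boundary (x * y).
Proof.
move=> /is_cycleE x0 /is_cycleE y0.
suff : is_boundary (- (x * y)) by move/boundaryN; rewrite opprK.
apply/is_boundaryE; exists ('s_0 x * 's_1 y - 's_0 (x * y)) => [|k kn].
  by rewrite dfaceB rmorphM !dface_degen // dface_degen_lt // y0 // degen0 mulr0 sub0r.
rewrite dfaceB rmorphM; have [->|k1] := eqVneq k 1%N.
  by rewrite !dfaceS_degen // dface_degen // subrr.
by rewrite !(dface_degen_gt (j := 0)) ?rmorphM ?x0 ?degen0 ?mul0r ?degen0 ?subrr //; lia.
Qed.

Section Frobenius.
Variables (p : nat) (p_pr : prime p).

Lemma exprSpred (A : comPzRingType) (x : A) : x ^+ p = x ^+ p.-1 * x.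
Proof. by rewrite -exprSr prednK // prime_gt0. Qed.

Lemma exprDp (A : sAlg p) n (x y : A n) : (x + y) ^+ p = x ^+ p + y ^+ p.
Proof. by apply: exprDn_prime => //; apply: sAlg_char. Qed.

Lemma boundaryXp (A : sAlg p) n (x : A n) : is_boundary x -> is_boundary (x ^+ p).
Proof. by rewrite exprSpred; apply: boundaryM. Qed.

(** As [p.-1] is positive, [x ^+ p.-1] is again a cycle, and products of cycles in positive degree
    bound. *)
Lemma boundary_cycleXp (A : sAlg p) n (x : A n.+1) :
  is_cycle x -> is_boundary (x ^+ p).
Proof.
move=> cx; rewrite exprSpred; apply: boundary_cycleM => //.
move: cx => /is_cycleE cx; apply/is_cycleE => k kn.
rewrite rmorphXn /= cx // expr0n.
by have -> : (p.-1 == 0)%N = false by have := prime_gt1 p_pr; lia.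
Qed.

(** * Powers of relative cycles *)

Variables (R Q : sAlg p) (i : sHom R Q).

Lemma rel_boundaryXp n (x : Q n) : rel_boundary i x -> rel_boundary i (x ^+ p).
Proof.
move=> [r /boundaryXp xr]; exists (r ^+ p).
suff -> : x ^+ p - i n (r ^+ p) = (x - i n r) ^+ p by [].
by rewrite -{1}[x](subrK (i n r)) [in LHS]exprDp rmorphXn addrK.
Qed.

Lemma rel_cycle1 n : rel_cycle i (1 : Q n).
Proof. by case: n => //= n k kn; rewrite rmorph1; apply: inR1. Qed.

Lemma rel_cycleM n (x y : Q n) : rel_cycle i x -> rel_cycle i y -> rel_cycle i (x * y).
Proof.
case: n x y => //= n x y xZ yZ k kn; rewrite rmorphM.
by apply: inRM; [apply: xZ | apply: yZ].
Qed.

(** The span over [R] of the [p]-th powers of relative cycles. It is a subring because relative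
    cycles are closed under products, so membership can be tested on the two factors of a
    pushout. *)
Inductive Frobenius_span n : Q n -> Prop :=
| Frobenius_span0 : Frobenius_span 0
| Frobenius_spanS r x z :
    rel_cycle i x -> Frobenius_span z -> Frobenius_span (i n r * x ^+ p + z).

Lemma Frobenius_spanD n (x y : Q n) :
  Frobenius_span x -> Frobenius_span y -> Frobenius_span (x + y).
Proof.
move=> xJ yJ; elim: xJ => [|r {}x z xZ zJ IH]; first by rewrite add0r.
by rewrite -addrA; apply: Frobenius_spanS.
Qed.

Lemma Frobenius_spanZ n r x (y : Q n) : rel_cycle i x ->
  Frobenius_span y -> Frobenius_span (i n r * x ^+ p * y).
Proof.
move=> xZ; elim=> [|r' x' z x'Z zJ IH]; first by rewrite mulr0; left.
rewrite mulrDr mulrACA -rmorphM -exprMn.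
by apply: Frobenius_spanS => //; apply: rel_cycleM.
Qed.

Lemma Frobenius_spanM n (x y : Q n) :
  Frobenius_span x -> Frobenius_span y -> Frobenius_span (x * y).
Proof.
move=> xJ yJ; elim: xJ => [|r {}x z xZ zJ IH]; first by rewrite mul0r; left.
by rewrite mulrDl; apply: Frobenius_spanD => //; apply: Frobenius_spanZ.
Qed.

Lemma Frobenius_span_mem n r (x : Q n) : rel_cycle i x -> Frobenius_span (i n r * x ^+ p).
Proof. by move=> xZ; rewrite -[_ * _]addr0; apply: Frobenius_spanS => //; left. Qed.

Lemma Frobenius_span_inR n r : Frobenius_span (i n r).
Proof.
have := Frobenius_span_mem r (@rel_cycle1 n).
by rewrite expr1n mulr1.
Qed.

Lemma Frobenius_spanB n (x y : Q n) :
  Frobenius_span x -> Frobenius_span y -> Frobenius_span (x - y).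
Proof.
move=> xJ yJ; apply: Frobenius_spanD => //; rewrite -mulN1r.
apply: Frobenius_spanM => //; rewrite -(rmorph1 (i n)) -rmorphN.
exact: Frobenius_span_inR.
Qed.

Lemma rel_boundary_span n (x : Q n) : Frobenius_span x ->
  (forall y : Q n, rel_cycle i y -> rel_boundary i (y ^+ p)) -> rel_boundary i x.
Proof.
move=> xJ ZB; elim: xJ => [|r y z yZ _ IH].
  by apply: rel_boundary_inR; apply: inR0.
by apply: rel_boundaryD => //; apply/rel_boundaryZ/ZB.
Qed.

(** The Frobenius is additive and sends [i r * y ^+ p] to an [R]-multiple of [(y ^+ p) ^+ p]. *)
Lemma rel_boundary_spanXp n (x : Q n) : Frobenius_span x ->
  (forall y : Q n, rel_cycle i y -> rel_boundary i ((y ^+ p) ^+ p)) ->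
  rel_boundary i (x ^+ p).
Proof.
move=> xJ ZB; elim: xJ => [|r y z yZ _ IH].
  rewrite expr0n gtn_eqF ?prime_gt0 //.
  by apply: rel_boundary_inR; apply: inR0.
rewrite exprDp exprMn -rmorphXn; apply: rel_boundaryD => //.
exact/rel_boundaryZ/ZB.
Qed.

Hypothesis i_inj : forall n, injective (i n).

(** The connecting map on elements: subtracting a horn filler from [R] kills every face but face
    [0], and [c] represents the image of [y] in the homotopy of [R]. *)
Lemma rel_cycle_normal n (y : Q n.+1) : rel_cycle i y ->
  exists e c, [/\ is_cycle c, 'd_0 (y - i _ e) = i n c
    & forall k, (0 < k <= n.+1)%N -> 'd_k (y - i _ e) = 0].
Proof.
move=> yZ; have [|e ye] := kan_inR i_inj (y := y).
  by move=> k /andP[_ kn]; apply: yZ.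
have y0 k : (0 < k <= n.+1)%N -> 'd_k (y - i _ e) = 0.
  by move=> kn; rewrite dfaceB ye // sHom_dface subrr.
have [c yc] : inR i ('d_0 (y - i _ e)).
  by rewrite dfaceB sHom_dface; apply: inRB; [apply: yZ | apply: inRi].
exists e, c; split=> //; move: yc y0; move: (y - i _ e) => z.
case: n {y yZ e ye} c z => [//|n] c z zc z0; apply/is_cycleE => k kn.
apply: i_inj; rewrite rmorph0 -sHom_dface -zc.
by rewrite -[k]/(k.+1.-1) -dface_dface ?z0 ?rmorph0 //; lia.
Qed.

(** The first Frobenius kills the connecting image [c], so [y ^+ p] agrees modulo [R] with an
    absolute cycle; the second kills that cycle. *)
Lemma rel_boundary_Frobenius2 n (y : Q n.+1) :
  (forall c : R 0%N, is_boundary (i 0%N c) -> is_boundary c) ->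
  rel_cycle i y -> rel_boundary i ((y ^+ p) ^+ p).
Proof.
move=> i0_inj /rel_cycle_normal[e [c [cZ yc y0]]].
have /is_boundaryE[e' e'c e'0] : is_boundary (c ^+ p).
  (* In degree [0] products of cycles need not bound; there [i c] bounds, hence so does [c]. *)
  case: n y e c cZ yc y0 => [|n] y e c cZ yc y0; last exact: boundary_cycleXp.
  by apply/boundaryXp/i0_inj/is_boundaryE; exists (y - i _ e).
have zZ : is_cycle ((y - i _ e) ^+ p - i _ e').
  apply/is_cycleE => k kn; rewrite dfaceB rmorphXn sHom_dface /=.
  have [->|k0] := posnP k; first by rewrite yc e'c rmorphXn subrr.
  rewrite y0 ?e'0 ?rmorph0 ?subr0; try lia.
  by rewrite expr0n gtn_eqF ?prime_gt0.
exists ((e' + e ^+ p) ^+ p); have := boundary_cycleXp zZ.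
suff -> : (y ^+ p) ^+ p - i n.+1 ((e' + e ^+ p) ^+ p) =
    ((y - i _ e) ^+ p - i _ e') ^+ p by [].
have -> : y ^+ p = (y - i _ e) ^+ p - i _ e' + i _ (e' + e ^+ p).
  by rewrite rmorphD addrA subrK rmorphXn -exprDp subrK.
by move: (_ - i _ e') => z; rewrite (exprDp (A := Q)) rmorphXn addrK.
Qed.

End Frobenius.

(** * Relatively perfect maps *)

(** Sending all generators to [0] gives a retraction of [i]. *)
Lemma polynomial_on_inj (A B : comPzRingType) (i : {rmorphism A -> B}) X :
  polynomial_on i X -> injective i.
Proof.
move=> [ex _]; have [k [ki _]] := ex A idfun (fun=> 0).
exact: can_inj ki.
Qed.

Lemma rel_acyclic_equivalence p (R Q : sAlg p) (i : sHom R Q) :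
  (forall n, injective (i n)) ->
  (forall n (x : Q n), rel_cycle i x -> rel_boundary i x) -> equivalence i.
Proof.
move=> i_inj acyclic; apply/equivalenceP => n; split=> [r _|y yZ].
  move=> /is_boundaryE[y yr y0]; apply/is_boundaryE.
  (* The chain [y] bounding [i r] is a relative cycle. It differs from [i e] by a boundary, whose
     faces vanish, so [e] has the faces of [y] and bounds [r]. *)
  have [|e /is_boundaryE[y' y'e y'0]] := acyclic _ y.
    move=> k kn; have [->|k0] := posnP k; first by rewrite yr; apply: inRi.
    by rewrite y0 ?k0 //; apply: inR0.
  have ye k : (k <= n.+1)%N -> 'd_k y = i _ ('d_k e).
    move=> kn; apply/eqP; rewrite -subr_eq0 -sHom_dface -dfaceB -y'e.
    by rewrite -(dface_dface (i := 0) (j := k.+1)) // y'0 ?rmorph0.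
  exists e => [|k kn]; apply: i_inj; first by rewrite -ye.
  by rewrite -ye ?y0 ?rmorph0 //; lia.
have [|r yr] := acyclic _ y.
  case: n y yZ => //= n y /is_cycleE yZ k kn.
  by rewrite yZ //; apply: inR0.
exists r; last by rewrite -opprB; apply: boundaryN.
case: n y yZ r yr => //= n y yZ r /is_boundaryE[y' y'y y'0].
apply/is_cycleE => k kn; apply: i_inj; rewrite rmorph0 -sHom_dface.
move/is_cycleE: yZ => yZ.
have -> : i n.+1 r = y - 'd_0 y' by rewrite y'y opprB addrC subrK.
by rewrite dfaceB yZ // -(dface_dface (i := 0) (j := k.+1)) // y'0 // rmorph0 subrr.
Qed.

(** * Acyclicity of the resolution of a relatively perfect map *)

Section RelativelyPerfect.
Variables (p : nat) (p_pr : prime p) (R S : sAlg p) (f : sHom R S).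
Variables (D : derived_pushout f (frobenius p_pr R)) (h : sHom D S).
Hypotheses (hF : is_relative_frobenius h) (hE : equivalence h).
Hypothesis H0f : ring_isomorphism (H0_hom f).
Local Notation Q := (dp_res D).
Local Notation i := (dp_in D).
Local Notation aug := (dp_aug D).
Local Notation inl := (dp_inl D).
Local Notation inr := (dp_inr D).

Let augE n :
  (forall x, is_cycle x -> is_boundary (aug n x) -> is_boundary x) /\
  (forall y, is_cycle y -> exists2 x, is_cycle x & is_boundary (aug n x - y)).
Proof. exact: (iffLR (equivalenceP _) (dp_aug_equiv D)). Qed.

Let aug_i n r : aug n (i n r) = f n r.
Proof. exact: (dp_factor D). Qed.

(** The relative Frobenius is lifted through [aug] to [Q], where it can be compared with [R];
    uniqueness of maps out of the pushout gives the compatibilities. *)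
Lemma relative_frobenius_resolution : exists u : forall n, {rmorphism D n -> Q n},
  [/\ forall n q, u n (inl n q) = q ^+ p,
      forall n r, u n (inr n r) = i n r,
      forall n x, aug n (u n x) = h n x
    & forall n k x, u n ('d_k x) = 'd_k (u n.+1 x)].
Proof.
have [hl hr] := hF.
have ex_u n : exists u : {rmorphism D n -> Q n},
    (forall q, u (inl n q) = q ^+ p) /\ (forall r, u (inr n r) = i n r).
  have [_ univ] := dp_pushout D n.
  have [|u [ul ur] _] := univ _ (frobenius p_pr Q n) (i n); last by exists u.
  by move=> r; rewrite /= /frob_fun rmorphXn.
pose u n := sval (cid (ex_u n)).
have ul n q : u n (inl n q) = q ^+ p by case: (svalP (cid (ex_u n))).
have ur n r : u n (inr n r) = i n r by case: (svalP (cid (ex_u n))).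
have eq_pushout n (T : comPzRingType) (g g' : {rmorphism D n -> T}) :
    (forall q, g (inl n q) = g' (inl n q)) ->
    (forall r, g (inr n r) = g' (inr n r)) -> g =1 g'.
  have [comm univ] := dp_pushout D n => gl gr x.
  have [|g0 _ g0u] := univ _ (g' \o inl n) (g' \o inr n).
    by move=> r; rewrite /= comm.
  by rewrite (g0u g) // (g0u g').
exists u; split=> // [n|n k].
  apply: (eq_pushout _ _ (aug n \o u n)) => [q|r] /=.
    by rewrite ul; have /= -> := hl n q; rewrite /frob_fun rmorphXn.
  by rewrite ur aug_i; have /= -> := hr n r.
apply: (eq_pushout _ _ (u n \o dface D n k) (dface Q n k \o u n.+1)) => [q|r] /=.
  by rewrite sHom_dface !ul rmorphXn.
by rewrite !sHom_dface !ur sHom_dface.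
Qed.

Lemma resolution_acyclic n (x : Q n) : rel_cycle i x -> rel_boundary i x.
Proof.
have [X [poly _]] := dp_free D.
have i_inj k : injective (i k) := polynomial_on_inj (poly k).
have [f0_inj f0_surj] := iffLR (H0_homP f) H0f.
have i0_inj c : is_boundary (i 0%N c) -> is_boundary c.
  by move=> /(sHom_boundary aug); rewrite aug_i; apply: f0_inj.
have [u [ul ur au ud]] := relative_frobenius_resolution.
have hE' := iffLR (equivalenceP _) hE.
elim/ltn_ind: n x => -[|n] IH x xZ.
  (* Degree [0] uses surjectivity of [f] and injectivity of [aug] on [H0]. *)
  have [r rx] := f0_surj (aug _ x); exists r.
  rewrite -opprB; apply: boundaryN.
  case: (augE 0) => + _; apply=> //.
  by rewrite rmorphB aug_i.
have [|g [gi gZ gB]] := rel_cycle_retract (n := n) i_inj poly; first exact: IH.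
(* Surjectivity of the relative Frobenius on relative homology, by a chase through the connecting
   map. *)
have lift y : rel_cycle i y -> exists w : D n.+1,
    rel_cycle i (u _ w) /\ rel_boundary i (y - u _ w).
  move=> /(rel_cycle_normal i_inj)[e [c [cZ yc y0]]].
  move: yc y0; set y' := _ - _ => yc y0.
  (* Both [aug] and [h] see the class of [c]: it bounds after [i], and injectivity of [h] on
     homotopy brings this back to the pushout. *)
  have /is_boundaryE[v vc v0] : is_boundary (inr n c).
    case: (hE' n) => + _; apply; first exact/asboolP/(sHom_cycle inr)/asboolT.
    rewrite -au ur; apply: (sHom_boundary aug).
    by apply/is_boundaryE; exists y'.
  have y'vZ : is_cycle (y' - u _ v).
    apply/is_cycleE => k kn; rewrite dfaceB -ud.
    have [->|k0] := posnP k; first by rewrite yc vc ur subrr.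
    by rewrite y0 ?v0 ?rmorph0 ?subrr ?k0.
  (* After correction by [v] the cycle is absolute, so surjectivity of [h] on homotopy applies. *)
  case: (hE' n.+1) => _ /(_ (aug _ (y' - u _ v))) [].
    exact/asboolP/(sHom_cycle aug)/asboolT.
  move=> z zZ; rewrite -au -rmorphB => zB.
  exists (v + z); split=> [k kn|].
    rewrite -ud rmorphD (iffLR (is_cycleE _) zZ) // addr0.
    have [->|k0] := posnP k; first by rewrite vc ur; apply: inRi.
    by rewrite v0 ?rmorph0 ?k0 //; apply: inR0.
  exists e; have -> : y - u n.+1 (v + z) - i n.+1 e = - (u _ z - (y' - u _ v)).
    by rewrite /y' rmorphD opprB addrAC opprD addrA.
  apply/boundaryN; case: (augE n.+1) => + _; apply=> //.
  apply/is_cycleE => k kn; rewrite dfaceB (iffLR (is_cycleE _) y'vZ) // subr0 -ud.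
  by rewrite (iffLR (is_cycleE _) zZ) // rmorph0.
(* On the left factor [g] turns [q ^+ p] into the [p]-th power of the relative cycle [g q]; on the
   right factor it fixes [R]. *)
have span w : Frobenius_span i (g (u _ w)).
  apply: (ring_pushout_subring (J := @Frobenius_span p _ _ i n.+1)
    (h := g \o u _) _ _ _ (dp_pushout D n.+1)) => /=.
  - by rewrite -(rmorph1 (i n.+1)); apply: Frobenius_span_inR.
  - exact: Frobenius_spanB.
  - exact: Frobenius_spanM.
  - move=> q; rewrite ul rmorphXn -[_ ^+ _]mul1r -(rmorph1 (i n.+1)).
    exact: Frobenius_span_mem.
  - by move=> r; rewrite ur gi; apply: Frobenius_span_inR.
have decomp (y : Q n.+1) : rel_cycle i y ->
    exists2 j, Frobenius_span i j & rel_boundary i (y - j).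
  move=> /lift[w [wZ yw]]; exists (g (u _ w)) => //.
  by rewrite -(subrKA (u _ w)); apply: rel_boundaryD => //; apply: gB.
(* Writing [y] as a combination of [p]-th powers turns its own [p]-th power into a combination of
   twofold Frobenius images, which bound. *)
have frobB (y : Q n.+1) : rel_cycle i y -> rel_boundary i (y ^+ p).
  move=> /decomp[j jJ yj]; rewrite -(subrK j y) exprDp //.
  apply: rel_boundaryD; first exact: rel_boundaryXp.
  by apply: rel_boundary_spanXp => // z; apply: rel_boundary_Frobenius2.
have [j jJ xj] := decomp _ xZ; rewrite -(subrK j x).
by apply: rel_boundaryD => //; apply: rel_boundary_span jJ frobB.
Qed.

(** Acyclicity makes [i] an equivalence, and [f] is the composite of [i] with the equivalence
    [aug]. *)
Lemma relatively_perfect_equivalence : equivalence f.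
Proof.
have [X [poly _]] := dp_free D.
have iE : equivalence i.
  apply: rel_acyclic_equivalence => n; last exact: resolution_acyclic.
  exact: polynomial_on_inj (poly n).
move=> n; apply: (eq_bij (bij_comp (dp_aug_equiv D n) (iE n))) => u /=.
rewrite [homotopy_map i u]/homotopy_map homotopy_map_pi /homotopy_map.
have -> // : cycle_map aug (cycle_map i (repr u)) = cycle_map f (repr u).
by apply: val_inj; rewrite /= aug_i.
Qed.

End RelativelyPerfect.

(** * The converse direction *)

Section Equivalence.
Variables (p : nat) (p_pr : prime p) (R S : sAlg p) (f : sHom R S).
Hypothesis fE : equivalence f.

Lemma equivalence_H0 : ring_isomorphism (H0_hom f).
Proof.
have [f_inj f_surj] := iffLR (equivalenceP f) fE 0%N.
apply/H0_homP; split=> [x|y]; first exact: f_inj.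
by have [//|x _ fx] := f_surj y; exists x.
Qed.

Definition sHom_id (A : sAlg p) : sHom A A :=
  @SHom p A A (fun n => idfun) (fun m n a x => erefl).

Lemma free_map_id (A : sAlg p) : free_map (sHom_id A).
Proof.
exists (fun _ _ => False); split=> // n; split=> [T h v|T k k' kk' _ b].
  by exists h.
exact: kk'.
Qed.

Lemma ring_pushout_id (A B : comPzRingType) (g : {rmorphism A -> B}) :
  ring_pushout idfun g g idfun.
Proof.
split=> // T h k hk; exists k => [|u' _ u'k x]; last exact: u'k.
by split=> // a; rewrite -hk.
Qed.

(* An equivalence is resolved by its source. *)
Lemma equivalence_relatively_perfect : relatively_perfect p_pr f.
Proof.
have factor : sHom_eq (sHom_comp f (sHom_id R)) f by [].
pose D := @DerivedPushout p R S R f (frobenius p_pr R) R (sHom_id R) f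
  (free_map_id R) fE factor R (frobenius p_pr R) (sHom_id R)
  (fun n => ring_pushout_id _).
(* For this pushout the relative Frobenius is [f] itself, since ring morphisms commute with [p]-th
   powers. *)
exists D, f; split=> //; split=> // n x /=.
by rewrite /frob_fun rmorphXn.
Qed.

End Equivalence.

Theorem corollary3p12 (p : nat) (p_pr : prime p) (R S : sAlg p) (f : sHom R S) :
  equivalence f <-> relatively_perfect p_pr f /\ ring_isomorphism (H0_hom f).
Proof.
split=> [fE|[[D [h [hF hE]]] H0f]]; last exact: relatively_perfect_equivalence hF hE H0f.
by split; [apply: equivalence_relatively_perfect | apply: equivalence_H0].
Qed.
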